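(* Let $A\in\mathbb{C}^{N\times N}$, $v\in\mathbb{C}^N$, and let $$AW_{m+l}=W_{m+l}K_{m+l}+w\,k_{m+l}^{T}$$ be a Krylov-like decomposition of $A$ with respect to $\mathcal{K}_m(A,v)$. Assume that $f(z)$ is analytic in the closed convex set $\Omega\subset\mathbb{C}$ and on its boundary, where $\Omega$ contains the field of values $F(A)$ and the field of values $F(K_{m+l})$, and that there exists a positive constant $C$ such that $\max_{z\in\Omega}|f^{(k)}(z)|\le C$ for all $k\ge 0$. Let $\{z_i\}_{i=0}^\infty$ be a sequence with $z_i\in\Omega$ for all $i\ge 0$, ordered so that equal points are contiguous, let $\{\phi_k\}_{k\ge 0}$ be the associated functions defined in the context, and let $q_0(z)=1$, $q_k(z)=(z-z_0)\cdots(z-z_{k-1})$ for $k\ge 1$. Let $\hat b\in\mathbb{C}^{m+l}$ be any vector satisfying $W_{m+l}\hat b=v$. Then the error $E_m(f)$ produced by the Krylov-like approximation satisfies the expansion $$E_m(f)=f(A)v-W_{m+l}f(K_{m+l})\hat b=\sum_{k=1}^{\infty}\bigl(k_{m+l}^T\,\phi_k(K_{m+l})\,\hat b\bigr)\;q_{k-1}(A)w .$$ In particular, if $z_0,z_1,\ldots,z_{N-1}$ are the $N$ exact eigenvalues of $A$ counting multiplicities, then the infinite series simplifies to a finite one: $$E_m(f)=f(A)v-W_{m+l}f(K_{m+l})\hat b=\sum_{k=1}^{N}\bigl(k_{m+l}^T\,\phi_k(K_{m+l})\,\hat b\bigr)\;q_{k-1}(A)w .$$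
   Context: The field of values of a square matrix $B$ is $F(B)=\{x^*Bx: x^*x=1\}$. The Krylov subspace is $\mathcal{K}_m(A,v)=\mathrm{span}\{v,Av,\ldots,A^{m-1}v\}$. A Krylov-like decomposition of $A$ with respect to $\mathcal{K}_m(A,v)$ is an identity $AW_{m+l}=W_{m+l}K_{m+l}+w\,k_{m+l}^{T}$ with $K_{m+l}\in\mathbb{C}^{(m+l)\times(m+l)}$, $W_{m+l}\in\mathbb{C}^{N\times(m+l)}$ such that $\mathrm{range}(W_{m+l})=\mathcal{K}_m(A,v)$, $w\in\mathcal{K}_{m+1}(A,v)\setminus\mathcal{K}_m(A,v)$ and $k_{m+l}\in\mathbb{C}^{m+l}$. The associated Krylov-like approximation to $f(A)v$ is $W_{m+l}f(K_{m+l})\hat b$, where $\hat b$ is any vector with $W_{m+l}\hat b=v$, and its error is $E_m(f)=f(A)v-W_{m+l}f(K_{m+l})\hat b$. ''Equal points are contiguous'' means: if $z_i=z_j$ with $i<j$, then $z_i=z_{i+1}=\cdots=z_j$. The functions $\phi_k$ are defined by the recurrence $$\phi_0(z)=f(z),\qquad \phi_{k+1}(z)=\frac{\phi_k(z)-\phi_k(z_k)}{z-z_k},\quad k\ge 0,$$ with the value at $z=z_k$ defined by continuity; each $\phi_k$ is then analytic. Matrix functions are taken in the usual sense (equivalently via Hermite interpolation, the Jordan canonical form or the Cauchy integral).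
   Formalization: The infinite expansion is stated under the added assumption that the sequence z_i is bounded (automatic if Ω is bounded); for unbounded Ω and unbounded z_i the claim can fail, e.g. f=exp, Ω={Re z≤0}, z_i=-i². The finite expansion has no added assumption. *)

(* Defs.v *)
From HB Require Import structures.
From mathcomp Require Import all_boot all_order all_algebra.
From mathcomp Require Import all_classical all_reals all_analysis.
From mathcomp.real_closed Require Export complex.

Set Implicit Arguments.
Unset Strict Implicit.
Unset Printing Implicit Defensive.

Import Order.TTheory GRing.Theory Num.Theory numFieldNormedType.Exports.
Local Open Scope classical_set_scope.
Local Open Scope sesquilinear_scope.
Local Open Scope ring_scope.

(* R[i] gets the topology of the modulus, as every numFieldType does, and is  *)
(* a normed module over itself: derivatives on it are complex derivatives.    *)
HB.instance Definition _ (R : rcfType) := NormedModule.copy R[i] R[i]^o.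
HB.instance Definition _ (R : rcfType) := PseudoPointedMetric.copy R[i] R[i]^o.

Section MatrixFunctions.
Variable C : numClosedFieldType.
Implicit Types (f : C -> C) (p q : {poly C}).

(* horner_mx is restricted to sizes of the form n.+1; see mx_evalE. *)
Definition mx_eval p n (B : 'M[C]_n) : 'M[C]_n :=
  \sum_(i < size p) p`_i *: B ^+ i.

(* Eigenvalues are counted with algebraic multiplicity; for analytic f this   *)
(* yields the same matrix as interpolation at the roots of the minimal        *)
(* polynomial.                                                                *)
Definition hermite_interpolates f n (B : 'M[C]_n) p : Prop :=
  forall (a : C) (j : nat), (j < mup a (char_poly B))%N ->
    p^`(j).[a] = derive1n j f a.

(* An interpolant always exists (hermite_interpolant_ex) and the matrix does  *)
(* not depend on its choice (mxfunE).                                         *)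
Definition mxfun f n (B : 'M[C]_n) : 'M[C]_n :=
  mx_eval (xget 0 [set p | hermite_interpolates f B p]) B.

Lemma mx_evalE p n (B : 'M[C]_n.+1) : mx_eval p B = horner_mx B p.
Proof.
rewrite -[p in RHS]coefK poly_def rmorph_sum /=; apply: eq_bigr => i _.
by rewrite linearZ /= rmorphXn /= horner_mx_X.
Qed.

Let derivM_XsubC_exp (a : C) m q :
  (('X - a%:P) ^+ m.+1 * q)^`() =
  ('X - a%:P) ^+ m * (q *+ m.+1 + ('X - a%:P) * q^`()).
Proof.
rewrite derivM deriv_exp derivXsubC mul1r /= mulrDr mulrnAl mulrnAr.
by rewrite exprSr mulrA.
Qed.

Let derivn_XsubC_low (a : C) j m q : (j < m)%N ->
  ((('X - a%:P) ^+ m * q)^`(j)).[a] = 0.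
Proof.
elim: j m q => [|j IH] [|m] q // ltjm.
  by rewrite derivn0 hornerM exprS hornerM hornerXsubC subrr !mul0r.
by rewrite derivSn derivM_XsubC_exp IH.
Qed.

Let derivn_XsubC_eq (a : C) m q :
  ((('X - a%:P) ^+ m * q)^`(m)).[a] = q.[a] *+ m`!.
Proof.
elim: m q => [|m IH] q; first by rewrite expr0 mul1r derivn0.
rewrite derivSn derivM_XsubC_exp IH hornerD hornerMn hornerM hornerXsubC.
by rewrite subrr mul0r addr0 factS mulrnA.
Qed.

Let prodXsubC (s : seq C) := \prod_(x <- s) ('X - x%:P).

Let prodXsubC_neq0 s : prodXsubC s != 0.
Proof. by rewrite monic_neq0 // monic_prod_XsubC. Qed.

Let prodXsubC_split s x :
  {h | prodXsubC s = ('X - x%:P) ^+ count_mem x s * h & h.[x] != 0}.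
Proof.
exists (\prod_(y <- s | y != x) ('X - y%:P)).
  rewrite /prodXsubC (bigID (pred1 x)) /=; congr (_ * _).
  by rewrite (eq_bigr (fun=> 'X - x%:P)) ?big_const_seq ?iter_mulr_1 // => y /eqP->.
rewrite horner_prod prodf_seq_neq0; apply/allP => y _; apply/implyP => yx.
by rewrite hornerXsubC subr_eq0 eq_sym.
Qed.

Let hermite_ex (c : C -> nat -> C) s : exists p, forall a j,
  (j < count_mem a s)%N -> p^`(j).[a] = c a j.
Proof.
elim: s => [|x s [p pP]]; first by exists 0.
have [h sE hx] := prodXsubC_split s x.
set k := count_mem x s in sE.
pose d := (c x k - p^`(k).[x]) / (h.[x] *+ k`!).
have hk : h.[x] *+ k`! != 0 by rewrite mulrn_eq0 negb_or -lt0n fact_gt0.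
exists (p + d *: prodXsubC s) => a j /=.
rewrite derivnD derivnZ hornerD hornerZ => ltj.
have [ltja|geja] := ltnP j (count_mem a s).
  have [g -> _] := prodXsubC_split s a.
  by rewrite derivn_XsubC_low // mulr0 addr0 pP.
have xa : x = a.
  by apply/eqP; apply: contraLR ltj => /negbTE->; rewrite -leqNgt.
have jk : j = k.
  apply/eqP; rewrite eqn_leq /k xa geja andbT -ltnS.
  by move: ltj; rewrite xa eqxx.
by rewrite -xa jk sE derivn_XsubC_eq /d divfK // addrC subrK.
Qed.

Let hermite_dvd s g :
  (forall a j, (j < count_mem a s)%N -> g^`(j).[a] = 0) -> prodXsubC s %| g.
Proof.
elim: s => [|x s IH] gP; first by rewrite /prodXsubC big_nil dvd1p.
have /dvdpP[u gE] : prodXsubC s %| g.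
  by apply: IH => a j ltj; apply: gP; rewrite /= (leq_trans ltj) ?leq_addl.
have [h sE hx] := prodXsubC_split s x.
have /eqP ux : u.[x] == 0.
  have := gP x (count_mem x s); rewrite /= eqxx => /(_ (ltnSn _)) /eqP.
  rewrite gE sE mulrCA derivn_XsubC_eq hornerM mulrn_eq0 mulf_eq0 (negPf hx).
  by rewrite eqn0Ngt fact_gt0 orbF.
rewrite gE /prodXsubC big_cons dvdp_mul2r ?prodXsubC_neq0 //.
by rewrite dvdp_XsubCl; apply/rootP.
Qed.

Let char_poly_split n (B : 'M[C]_n) : {s | char_poly B = prodXsubC s}.
Proof.
have [s sE] := closed_field_poly_normal (char_poly B); exists s.
by rewrite sE (monicP (char_poly_monic B)) scale1r.
Qed.

Lemma hermite_interpolant_ex f n (B : 'M[C]_n) :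
  exists p, hermite_interpolates f B p.
Proof.
have [s sE] := char_poly_split B.
have [p pP] := hermite_ex (fun a j => derive1n j f a) s.
by exists p => a j; rewrite sE mu_prod_XsubC; apply: pP.
Qed.

Lemma mxfunE f n (B : 'M[C]_n) p :
  hermite_interpolates f B p -> mxfun f B = mx_eval p B.
Proof.
case: n B => [|n] B pP; first by apply/matrixP => -[].
rewrite /mxfun; case: xgetP => [_ -> p'P|]; last by move/(_ p).
rewrite !mx_evalE; apply/eqP; rewrite -subr_eq0 -rmorphB /=.
have [s sE] := char_poly_split B.
suff /dvdpP[u ->] : char_poly B %| xget 0 [set p | hermite_interpolates f B p] - p.
  by rewrite rmorphM /= Cayley_Hamilton mulr0.
rewrite sE; apply: hermite_dvd => a j ltj.
by rewrite derivnB hornerD hornerN p'P ?pP ?subrr // sE mu_prod_XsubC.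
Qed.

End MatrixFunctions.

Section KrylovLike.
Variable C : numClosedFieldType.

Definition field_of_values n (B : 'M[C]_n) : set C :=
  [set (x ^t* *m B *m x) 0 0 | x in [set x : 'cV[C]_n | x ^t* *m x = 1%:M]].

Definition krylov N (A : 'M[C]_N) (v : 'cV[C]_N) (m : nat) : {vspace 'cV[C]_N} :=
  <<[seq A ^+ i *m v | i <- iota 0 m]>>%VS.

Definition krylov_like N m l (A : 'M[C]_N) (v : 'cV[C]_N)
    (W : 'M[C]_(N, m + l)) (K : 'M[C]_(m + l)) (w : 'cV[C]_N)
    (k : 'cV[C]_(m + l)) : Prop :=
  [/\ A *m W = W *m K + w *m k^T,
      range (fun x : 'cV[C]_(m + l) => W *m x) = [set` krylov A v m],
      w \in krylov A v m.+1
    & w \notin krylov A v m].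

Definition krylov_like_error N n (f : C -> C) (A : 'M[C]_N) (v : 'cV[C]_N)
    (W : 'M[C]_(N, n)) (K : 'M[C]_n) (b : 'cV[C]_n) : 'cV[C]_N :=
  mxfun f A *m v - W *m mxfun f K *m b.

End KrylovLike.

Section NewtonExpansion.
Variable C : numClosedFieldType.
Implicit Types (f : C -> C) (z : nat -> C).

Definition analytic_at f (x : C) : Prop :=
  exists (a : nat -> C) (r : C), 0 < r /\ forall y, `|y - x| < r ->
    series (fun n => a n * (y - x) ^+ n) @ \oo --> f y.

Definition analytic_on f (D : set C) : Prop :=
  forall x, D x -> analytic_at f x.

Definition equal_points_contiguous z : Prop :=
  forall i j, (i < j)%N -> z i = z j ->
    forall k, (i <= k <= j)%N -> z k = z i.

(* The lim is the value by continuity at the node z k'. *)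
Fixpoint phi f z (k : nat) : C -> C :=
  if k is k'.+1 then
    fun x =>
      if x == z k'
      then lim ((phi f z k' y - phi f z k' (z k')) / (y - z k')
                @[y --> (z k')^'])
      else (phi f z k' x - phi f z k' (z k')) / (x - z k')
  else f.

Definition newton_poly z (k : nat) : {poly C} :=
  \prod_(i < k) ('X - (z i)%:P).

End NewtonExpansion.

(* Main.v *)
(* Since [phi_k = phi_k(z_k) + (x - z_k) phi_{k+1}] holds for matrix arguments  *)
(* as well, the Krylov-like relation gives                                    *)
(* [E(phi_k) = (k^T phi_{k+1}(K) b) w + (A - z_k) E(phi_{k+1})].  Iterating   *)
(* from [phi_0 = f] yields the partial sums of the expansion with remainder   *)
(* [q_n(A) E(phi_n)], which vanishes by Cayley-Hamilton when the nodes are    *)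
(* the eigenvalues of [A].  In general [q_n(A)] grows at most geometrically,  *)
(* while [E(phi_n) = O(1/n!)]: if [g = g(c) + (x - c) h] near a convex set,   *)
(* integrating [t^j g^(j+1)(c + t (x - c))] over [0, 1] shows that the        *)
(* supremum of [h^(j)] is at most that of [g^(j+1)] divided by [j + 1], hence *)
(* [|phi_n^(j)| <= M j! / (n + j)!].  The same estimate, applied along the    *)
(* Newton expansion at the eigenvalues of a matrix [B], bounds [g(B)] by the  *)
(* derivatives of [g].                                                        *)

(* An affine factor passes from [K] to [A] through the Krylov-like relation at the cost of one
   multiple of [w] ([krylov_like_error_rec]); iterating gives an exact identity with remainder
   ([krylov_like_error_newton]), and the finite expansion follows at once. For the series two
   estimates meet. Bounded nodes make [q_n(A)] grow at most geometrically
   ([ler_mxnorm1_newton_poly]). All derivatives of [phi_n] are at most [M / n!] on the convex set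
   ([derive1n_phi_bound_fact]), and this passes to [phi_n(A)] and [phi_n(K)] with constants
   independent of [n] ([mxfun_bound]). The remainder is thus dominated by a term of an exponential
   series. The groundwork is that dividing out a node preserves analyticity ([analytic_at_quot_neq],
   [analytic_at_quot_eq]), and that eigenvalues lie in the field of values
   ([root_char_poly_field_of_values]), which ties functions on the convex set to matrices. *)
Require Import Defs.
From mathcomp Require Import all_boot all_order all_algebra.
From mathcomp Require Import all_classical all_reals all_analysis.
From mathcomp.real_closed Require Import complex.
From mathcomp Require Import ring.

Import Order.TTheory GRing.Theory Num.Theory numFieldNormedType.Exports.
Local Open Scope classical_set_scope.
Local Open Scope complex_scope.
Local Open Scope ring_scope.

Set Implicit Arguments.
Unset Strict Implicit.
Unset Printing Implicit Defensive.

(* The form in which completeness and the Archimedean property are used.      *)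
Definition geometrically_complete (C : numFieldType) :=
  forall (u : nat -> C) (K : C),
    (forall n, `|u n| <= K * 2^-1 ^+ n) -> cvgn (series u).

(** * Quotients of power series *)

Section PowerSeries.
Variable C : numClosedFieldType.
Implicit Types (f g h : C -> C) (a : nat -> C) (x y c t : C).

Lemma cvgn_bounded (u : nat -> C) : cvgn u ->
  exists2 K : C, 0 < K & forall n, `|u n| <= K.
Proof.
move=> /cvg_seq_bounded ub.
have [K0 uK0] := (@ex_bound _ _ _ u (globally setT)
  (globally_properfilter (I : setT 0%N))).1 ub.
have uK n : `|u n| <= K0 by exact: uK0.
exists (K0 + 1) => [|n]; last by rewrite (le_trans (uK n))// lerDl.
by rewrite ltr_wpDl// (le_trans _ (uK 0%N)).
Qed.

(** Convergence at the single point [x + r / 2] bounds the terms there, which gives Cauchy's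
    estimate without an integral. *)
Lemma analytic_at_geometric f x : analytic_at f x ->
  exists a (K rho : C), [/\ 0 < K, 0 < rho, forall n, `|a n| <= K * rho ^+ n &
    forall t, `|t| * rho < 1 ->
      series (fun n => a n * t ^+ n) @ \oo --> f (x + t)].
Proof.
move=> [a [r [r0 ar]]].
have r2 : 0 < r / 2 by rewrite divr_gt0.
have /ar/cvgP/cvg_series_cvg_0/cvgP/cvgn_bounded[K K0 aK] :
    `|x + r / 2 - x| < r.
  by rewrite addrC addKr gtr0_norm// ltr_pdivrMr// ltr_pMr// ltr1n.
exists a, K, (r / 2)^-1; split => //; first by rewrite invr_gt0.
  move=> n; have := aK n.
  rewrite addrC addKr normrM normrX (gtr0_norm r2) exprVn.
  by rewrite -ler_pdivlMr// exprn_gt0.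
move=> t; rewrite ltr_pdivrMr// mul1r => tr.
have /ar : `|x + t - x| < r.
  rewrite addrC addKr (lt_trans tr)// ltr_pdivrMr// ltr_pMr// ltr1n //.
by under eq_fun do rewrite addrC addKr.
Qed.

Lemma analytic_at_def f x a (r : C) : 0 < r ->
  (forall t, `|t| < r -> series (fun n => a n * t ^+ n) @ \oo --> f (x + t)) ->
  analytic_at f x.
Proof.
move=> r0 H; exists a, r; split => // y yr.
by have := H _ yr; rewrite addrCA subrr addr0.
Qed.

(* Multiplying [g = g c + (y - c) h] out gives [d b_n + b_{n-1} = a_n] for the *)
(* coefficients at [x], where [d = x - c].                                     *)
Fixpoint quot_coef a (d : C) n : C :=
  if n is n'.+1 then (a n - quot_coef a d n') / d else a 0 / d.

Lemma quot_coef_bound a (d K rho : C) : d != 0 -> 0 < K ->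
  0 < rho -> (forall n, `|a n| <= K * rho ^+ n) ->
  exists L sigma : C, [/\ 0 < L, 0 < sigma &
    forall n, `|quot_coef a d n| <= L * sigma ^+ n].
Proof.
move=> d0 K0 rho0 aK; have d0' : 0 < `|d|^-1 by rewrite invr_gt0 normr_gt0.
pose s := rho + `|d|^-1 + 1.
have s0 : 0 < s by rewrite !addr_gt0.
have s1 : `|d|^-1 <= s by rewrite /s addrAC lerDr ltW// addr_gt0.
(* The rate is doubled because the recursion adds two terms, each at most [s * (s + s) ^+ n] after
   factoring out [K / |d|]. *)
exists (K * `|d|^-1), (s + s).
have ss0 : 0 < s + s by rewrite addr_gt0.
have L0 : 0 < K * `|d|^-1 by rewrite mulr_gt0.
split => //; elim => [|n IH] /=.
  by rewrite normrM normfV expr0 mulr1 ler_pM2r//; have := aK 0%N; rewrite expr0 mulr1.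
rewrite normrM normfV.
apply: le_trans (_ : (K * rho ^+ n.+1 + K * `|d|^-1 * (s + s) ^+ n) * `|d|^-1 <= _).
  by rewrite ler_pM2r// (le_trans (ler_normB _ _))// lerD.
have S0 : 0 <= (s + s) ^+ n by rewrite exprn_ge0// ltW.
have rhos : rho ^+ n.+1 <= s * (s + s) ^+ n.
  apply: (@le_trans _ _ (s ^+ n.+1)).
    by rewrite lerXn2r ?nnegrE ?ltW// /s -addrA ltrDl addr_gt0.
  by rewrite exprS ler_pM2l// lerXn2r ?nnegrE ?ltW// ltrDl.
have -> : (K * rho ^+ n.+1 + K * `|d|^-1 * (s + s) ^+ n) * `|d|^-1 =
  K * `|d|^-1 * (rho ^+ n.+1 + `|d|^-1 * (s + s) ^+ n) by ring.
rewrite ler_pM2l// [(s + s) ^+ n.+1]exprS mulrDl lerD//.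
by rewrite ler_wpM2r.
Qed.

(** The product telescopes up to one boundary term, which is geometrically small near the centre. *)
Lemma quot_coef_partial_sum a (d t : C) n : d != 0 ->
  (t + d) * series (fun n => quot_coef a d n * t ^+ n) n.+1 =
  series (fun n => a n * t ^+ n) n.+1 + quot_coef a d n * t ^+ n.+1.
Proof.
move=> d0; elim: n => [|n IH].
  rewrite /series /= !big_nat1 /= expr0 expr1 !mulr1; field.
  exact: d0.
rewrite (seriesS _ n.+1) (seriesS (fun n => a n * t ^+ n)) mulrDr IH /= !exprS.
by field.
Qed.

Hypothesis completeC : geometrically_complete C.

(** In a general [C] the powers of [2^-1] need not tend to 0; here this comes from the convergence
    of the series. *)
Lemma geometric_cvg0 (u : nat -> C) (K : C) :
  (forall n, `|u n| <= K * 2^-1 ^+ n) -> u @ \oo --> 0.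
Proof. by move=> /completeC/cvg_series_cvg_0. Qed.

Lemma cvgn_eq (u v : nat -> C) (l : C) : (forall n, u n = v n) ->
  u @ \oo --> l -> v @ \oo --> l.
Proof. by move=> /funext ->. Qed.

Lemma cvgn_shift (u : nat -> C) (l : C) :
  (fun n => u n.+1) @ \oo --> l -> u @ \oo --> l.
Proof. by move=> H; rewrite -cvg_shiftS. Qed.

Lemma ler_half_geometric (t s : C) n : 0 <= s -> `|t| * s <= 2^-1 ->
  s ^+ n * `|t| ^+ n <= 2^-1 ^+ n.
Proof.
move=> s0 ts; rewrite -exprMn lerXn2r ?nnegrE ?mulr_ge0 ?invr_ge0//.
by rewrite mulrC.
Qed.

Lemma analytic_at_quot_neq g h x c : analytic_at g x -> x != c ->
  (forall y, y != c -> h y = (g y - g c) / (y - c)) -> analytic_at h x.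
Proof.
move=> /analytic_at_geometric[a [K [rho [K0 rho0 aK ag]]]] xc hE.
pose d := x - c; have d0 : d != 0 by rewrite subr_eq0.
pose a' n := if n == 0%N then a n - g c else a n.
have [K' K'0 a'K] : exists2 K' : C, 0 < K' & forall n, `|a' n| <= K' * rho ^+ n.
  exists (K + `|g c|) => [|[|n]]; first by rewrite ltr_pwDl.
    rewrite /a' /= expr0 mulr1 (le_trans (ler_normB _ _))// lerD2r.
    by have := aK 0%N; rewrite expr0 mulr1.
  by rewrite /a' /= (le_trans (aK _))// ler_pM2r ?exprn_gt0// lerDl.
have [L [s [L0 s0 bL]]] := quot_coef_bound d0 K'0 rho0 a'K.
(* [S] dominates three rates at once: [rho] for convergence of the series of [g], [s] for the
   boundary term to vanish, and [|d|^-1] to keep [t + d] away from 0. *)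
pose S := rho + s + `|d|^-1.
have S0 : 0 < S by rewrite !addr_gt0 ?invr_gt0 ?normr_gt0.
apply: (@analytic_at_def _ _ (quot_coef a' d) (2^-1 / S)).
  by rewrite divr_gt0.
move=> t; rewrite ltr_pdivlMr// => tS.
have small p : 0 <= p -> p <= S -> `|t| * p <= 2^-1.
  by move=> p0 pS; rewrite (le_trans _ (ltW tS))// ler_wpM2l.
have trho : `|t| * rho <= 2^-1.
  by rewrite small ?ltW// /S -addrA ltrDl addr_gt0 ?invr_gt0 ?normr_gt0.
have ts : `|t| * s <= 2^-1.
  rewrite small ?ltW// /S addrAC ltrDr addr_gt0 ?invr_gt0 ?normr_gt0//.
have half1 : 2^-1 < 1 :> C by rewrite invf_lt1 ?ltr1n.
have td0 : t + d != 0.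
  apply/eqP => /eqP; rewrite addr_eq0 => /eqP tE.
  have : `|t| * `|d|^-1 <= 2^-1.
    by rewrite small// ?invr_ge0// /S lerDr ltW// addr_gt0.
  rewrite tE normrN divff ?normr_eq0// => d2.
  by have := le_lt_trans d2 half1; rewrite ltxx.
have xtc : x + t != c.
  by rewrite -subr_eq0 addrAC addrC.
rewrite hE// (_ : x + t - c = t + d); last by rewrite addrAC addrC.
apply: cvgn_shift.
apply: (@cvgn_eq (fun n => (series (fun n => a n * t ^+ n) n.+1 - g c +
    quot_coef a' d n * t ^+ n.+1) / (t + d))).
  move=> n; rewrite (_ : _ - g c = series (fun n => a' n * t ^+ n) n.+1); last first.
    rewrite /series /= !big_nat_recl//= /a' /= expr0 !mulr1 addrAC; congr (_ + _).
  by rewrite -quot_coef_partial_sum// mulrAC divff// mul1r.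
apply: cvgMl; rewrite -[X in _ --> X]addr0; apply: cvgD.
  apply: cvgB; last exact: cvg_cst.
  have := ag t (le_lt_trans trho half1).
  by rewrite -cvg_shiftS.
apply: (@geometric_cvg0 _ (L * `|t|)) => n.
rewrite normrM normrX exprS mulrCA mulrA [L * _]mulrC -!mulrA ler_wpM2l//.
rewrite (le_trans (ler_wpM2r _ (bL n)))// ?exprn_ge0//.
rewrite -mulrA ler_pM2l// ler_half_geometric// ltW//.
Qed.
End PowerSeries.

(** * Termwise differentiation *)

Lemma derivable_quadratic (C : numFieldType) (f : C -> C) (y D B r : C) :
  0 < r -> 0 < B ->
  (forall e, `|e| < r -> `|f (y + e) - f y - e * D| <= B * `|e| ^+ 2) ->
  derivable f y 1 /\ derive1 f y = D.
Proof.
move=> r0 B0 fD.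
have fyD : h^-1 *: ((f \o shift y) (h *: 1) - f y) @[h --> 0^'] --> (D : C^o).
  apply/cvgrPdist_lt => eps eps0.
  near=> h.
  have h0 : h != 0 by near: h; exact: nbhs_dnbhs_neq.
  have hr : `|h| < r.
    near: h; apply: nbhs_dnbhs; exact: (@nbhs0_lt _ C^o).
  have he : `|h| < eps / B.
    near: h; apply: nbhs_dnbhs; apply: (@nbhs0_lt _ C^o); exact: divr_gt0.
  rewrite /= /GRing.scale /= mulr1 [h + y]addrC distrC.
  rewrite -(ltr_pM2l (_ : 0 < `|h|)) ?normr_gt0// -normrM mulrBr mulrA divff//.
  rewrite mul1r (le_lt_trans (fD _ hr))// expr2 mulrCA ltr_pM2l ?normr_gt0//.
  by rewrite mulrC -ltr_pdivlMr.
split; first by apply/cvg_ex; exists D.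
by rewrite derive1E /derive; apply: cvg_lim.
Unshelve. all: by end_near. Qed.

Section TermwiseDerivative.
Variable C : numClosedFieldType.
Implicit Types (f g h : C -> C) (a : nat -> C) (x y c t : C).

Lemma natr_le_exp2 n : n%:R <= 2 ^+ n :> C.
Proof. by rewrite -natrX ler_nat ltnW// ltn_expl. Qed.

Definition power_taylor2 t e n := (t + e) ^+ n - t ^+ n - e * (n%:R * t ^+ n.-1).

(** The remainders satisfy [r_(n+1) = (t + e) r_n + n t^(n-1) e^2], and [n <= 2 ^+ n] is absorbed by
    doubling [s]. The factor [s ^+ 2] on the left avoids the exponent [n - 2]. *)
Lemma power_taylor2_bound (s t e : C) n : `|t| <= s -> `|t + e| <= s ->
  s ^+ 2 * `|power_taylor2 t e n| <= `|e| ^+ 2 * (2 * s) ^+ n.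
Proof.
move=> ts tes; have s0 : 0 <= s by rewrite (le_trans _ ts).
elim: n => [|n IH].
  rewrite /power_taylor2 !expr0 mul0r mulr0 subr0 subrr normr0 mulr0 mulr1.
  exact: exprn_ge0.
have -> : power_taylor2 t e n.+1 =
    (t + e) * power_taylor2 t e n + n%:R * t ^+ n.-1 * e ^+ 2.
  rewrite /power_taylor2 /= -natr1; case: n {IH} => [|n] /=; first by ring.
  rewrite !exprS; ring.
apply: (@le_trans _ _ (s * (`|e| ^+ 2 * (2 * s) ^+ n) +
    `|e| ^+ 2 * (n%:R * s ^+ n.+1))).
  rewrite (le_trans (ler_wpM2l _ (ler_normD _ _))) ?exprn_ge0// mulrDr lerD//.
    rewrite normrM mulrCA (le_trans (ler_wpM2r _ tes)) ?mulr_ge0 ?exprn_ge0//.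
    exact: ler_wpM2l.
  rewrite !normrM !normrX normr_nat mulrA [leLHS]mulrC ler_wpM2l ?exprn_ge0//.
  case: n {IH} => [|n] /=; first by rewrite !mul0r mulr0.
  rewrite mulrCA ler_wpM2l// -[n.+2]add2n exprD ler_wpM2l ?exprn_ge0//.
  exact: lerXn2r.
rewrite mulrCA -mulrDr ler_wpM2l ?exprn_ge0// !exprMn mulrCA -exprS -mulrDl.
rewrite ler_wpM2r ?exprn_ge0// exprS mulr_natl mulr2n lerD2l.
exact: natr_le_exp2.
Qed.

Lemma ler_norm_limn (u : nat -> C) (l B : C) :
  u @ \oo --> l -> (forall n, `|u n| <= B) -> `|l| <= B.
Proof.
move=> ul uB.
have B0 : 0 <= B by rewrite (le_trans _ (uB 0%N)).
rewrite real_leNgt ?ger0_real// ?normr_real//; apply/negP => Bl.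
have e0 : 0 < `|l| - B by rewrite subr_gt0.
have /cvgrPdist_lt/(_ _ e0)[N _ /(_ N (leqnn N)) /= luN] := ul.
have : `|l| < `|l|.
  rewrite -{1}(subrK (u N) l) (le_lt_trans (ler_normD _ _))//.
  by rewrite -(subrK B `|l|) ltr_leD.
by rewrite ltxx.
Qed.

Hypothesis completeC : geometrically_complete C.

Lemma geometric_series_bound (u : nat -> C) (K : C) n :
  (forall n, `|u n| <= K * 2^-1 ^+ n) -> `|series u n| <= K * 2.
Proof.
move=> uK; have K0 : 0 <= K by have := uK 0%N; rewrite expr0 mulr1; apply: le_trans.
suff : `|series u n| <= K * 2 * (1 - 2^-1 ^+ n).
  move=> /le_trans; apply; rewrite ler_piMr ?mulr_ge0// lerBlDr lerDl.
elim: n => [|n IH]; first by rewrite /series /= big_geq// normr0 expr0 subrr mulr0.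
rewrite seriesS addrC (le_trans (ler_normD _ _))// (le_trans (lerD IH (uK n)))//.
rewrite le_eqVlt; apply/orP; left; by apply/eqP; rewrite exprS; field.
Qed.

(** Summing the second-order remainders of the monomials leaves an error quadratic in the increment,
    so the termwise derivative is the derivative. *)
Lemma analytic_at_derive f x : analytic_at f x ->
  analytic_at (derive1 f) x /\
  (\forall y \near x, derivable f y 1).
Proof.
move=> /analytic_at_geometric[a [K [rho [K0 rho0 aK af]]]].
(* One factor 2 per degree is lost to [n <= 2 ^+ n], so radius [4^-1 / rho] leaves the ratio [2^-1]
   required by [geometrically_complete]. *)
pose s := 4^-1 / rho; have s0 : 0 < s by rewrite divr_gt0.
have [s0w K0w rho0w] : [/\ 0 <= s, 0 <= K & 0 <= rho] by rewrite !ltW.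
have srho : s * rho = 4^-1 by rewrite divfK// gt_eqF.
clearbody s.
have half : 2 * 4^-1 = 2^-1 :> C by field.
have q1 : 4^-1 < 1 :> C by rewrite invf_lt1 ?ltr1n.
pose da t n := n%:R * a n * t ^+ n.-1.
have daK t n : `|t| <= s -> `|da t n| <= K / s * 2^-1 ^+ n.
  move=> ts; rewrite mulrAC ler_pdivlMr// /da !normrM normr_nat normrX.
  case: n => [|n]; first by rewrite !mul0r mulr_ge0 ?ltW ?exprn_gt0 ?invr_gt0.
  rewrite /=; apply: (@le_trans _ _ (2 ^+ n.+1 * (K * rho ^+ n.+1) * s ^+ n * s)).
    rewrite ler_wpM2r// ler_pM ?mulr_ge0 ?exprn_ge0//.
      by rewrite ler_pM// natr_le_exp2.
    by rewrite lerXn2r.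
  rewrite -half -srho le_eqVlt; apply/orP; left; apply/eqP.
  by rewrite !exprMn !exprS; ring.
have Dcvg t : `|t| <= s -> cvgn (series (da t)).
  by move=> ts; apply: (@completeC _ (K / s)) => n; apply: daK.
have fder t : `|t| < s ->
    derivable f (x + t) 1 /\ derive1 f (x + t) = limn (series (da t)).
  move=> ts; have st0 : 0 < s - `|t| by rewrite subr_gt0.
  apply: (@derivable_quadratic _ _ _ _ (K * 2 / s ^+ 2) (s - `|t|)) => //.
    by rewrite divr_gt0 ?mulr_gt0 ?exprn_gt0.
  move=> e es.
  have tes : `|t + e| <= s.
    by rewrite (le_trans (ler_normD _ _))// -lerBrDl ltW.
  have rhot t' : `|t'| <= s -> `|t'| * rho < 1.
    by move=> ts'; rewrite (le_lt_trans _ q1)// -srho ler_pM2r.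
  pose u n := a n * power_taylor2 t e n.
  have uK n : `|u n| <= K / s ^+ 2 * `|e| ^+ 2 * 2^-1 ^+ n.
    rewrite -mulrA mulrAC ler_pdivlMr ?exprn_gt0// /u normrM -mulrA.
    rewrite [_ * s ^+ 2]mulrC.
    rewrite (le_trans (ler_pM _ _ (aK n) (power_taylor2_bound n (ltW ts) tes)))//.
      by rewrite mulr_ge0 ?exprn_ge0.
    rewrite -half -srho le_eqVlt; apply/orP; left; apply/eqP.
    by rewrite !exprMn; ring.
  apply: (@ler_norm_limn (series u)); last first.
    move=> n; have -> : K * 2 / s ^+ 2 * `|e| ^+ 2 = K / s ^+ 2 * `|e| ^+ 2 * 2.
      by ring.
    exact: geometric_series_bound.
  rewrite -(addrA x).
  apply: (@cvgn_eq _ (fun n => series (fun n => a n * (t + e) ^+ n) n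
       - series (fun n => a n * t ^+ n) n - e * series (da t) n)).
    move=> n; rewrite /series /= big_distrr -!sumrB/=; apply: eq_bigr => i _.
    by rewrite /u /power_taylor2 /da; ring.
  apply: cvgB; first by apply: cvgB; apply: af; apply: rhot => //; exact: ltW.
  by apply: cvgMr; exact: (Dcvg _ (ltW ts)).
split; last first.
    apply/nbhs_ballP; exists s => //= y; rewrite -ball_normE /= => ys.
  by have [] := fder (y - x); rewrite ?subrKC// distrC.
apply: (@analytic_at_def _ _ _ (fun n => n.+1%:R * a n.+1) s) => // t ts.
rewrite (fder _ ts).2; have := Dcvg _ (ltW ts).
rewrite -cvg_shiftS; apply: cvgn_eq => n.
by rewrite /series /= big_nat_recl//= /da mul0r mul0r add0r.
Qed.
End TermwiseDerivative.

(** * Divided differences and matrix functions *)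

Lemma derive1_near_eq (C : numFieldType) (f g : C -> C) x :
  (\forall y \near x, f y = g y) -> derive1 f x = derive1 g x.
Proof. by move=> fg; rewrite !derive1E; apply: near_eq_derive. Qed.

Lemma derivnM_XsubC (R : comNzRingType) (c : R) (p : {poly R}) j :
  (('X - c%:P) * p)^`(j) = ('X - c%:P) * p^`(j) + p^`(j.-1) *+ j.
Proof.
elim: j => [|j IH]; first by rewrite !derivn0 mulr0n addr0.
rewrite derivnS IH derivD derivM derivXsubC mul1r derivMn -!derivnS addrAC addrC.
by case: j {IH} => [|j]; rewrite ?mulr0n ?addr0 //= -mulrSr.
Qed.

Section Quotient.
Variable C : numClosedFieldType.
Implicit Types (f g h : C -> C) (x y c : C).
Hypothesis completeC : geometrically_complete C.

Lemma analytic_at_continuous f x : analytic_at f x -> {for x, continuous f}.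
Proof.
move=> /(analytic_at_derive completeC)[_ /nbhs_singleton].
by move=> /derivable1_diffP/differentiable_continuous.
Qed.

Lemma analytic_at_derive1n f x j : analytic_at f x ->
  analytic_at (derive1n j f) x.
Proof.
move=> fx; elim: j => [//|j IH]; rewrite derive1nS.
by have [] := analytic_at_derive completeC IH.
Qed.

Lemma analytic_at_derive1n_derivable f x j : analytic_at f x ->
  \forall y \near x, derivable (derive1n j f) y 1.
Proof.
move=> /(analytic_at_derive1n j) fx.
by have [] := analytic_at_derive completeC fx.
Qed.

(** At the node the quotient is the power series with shifted coefficients. Its sum [q] is
    continuous, so the limit defining [h c] is the coefficient [a 1]. *)
Lemma analytic_at_quot_eq g h c : analytic_at g c ->
  (forall y, y != c -> h y = (g y - g c) / (y - c)) ->
  h c = lim ((g y - g c) / (y - c) @[y --> c^']) -> analytic_at h c.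
Proof.
move=> /analytic_at_geometric[a [K [rho [K0 rho0 aK ag]]]] hE hc.
have gc : g c = a 0%N.
  have := ag 0; rewrite normr0 mul0r addr0 => /(_ ltr01) g0.
  rewrite -(cvg_lim _ g0)//; apply: cvg_lim => //.
  rewrite -cvg_shiftS; apply: cvg_near_cst; near=> n.
  rewrite /series /= big_nat_recl//= mulr1 big1_seq ?addr0// => i _.
  by rewrite expr0n mulr0.
pose q y := if y == c then a 1%N else (g y - g c) / (y - c).
have qan : analytic_at q c.
  apply: (@analytic_at_def _ _ _ (fun n => a n.+1) rho^-1) => [|t].
    by rewrite invr_gt0.
  rewrite -[_^-1]mul1r ltr_pdivlMr// => /ag gt.
  rewrite /q -subr_eq0 addrC addKr; case: eqP => [->|/eqP t0].
    apply: cvgn_shift; apply: cvg_near_cst; near=> n.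
    rewrite /series /= big_nat_recl//= mulr1 big1_seq ?addr0// => i _.
    by rewrite expr0n mulr0.
  apply: (@cvgn_eq _ (fun n => (series (fun n => a n * t ^+ n) n.+1 - g c) / t)).
    move=> n; rewrite /series /= big_nat_recl//= mulr1 gc addrC addKr mulr_suml.
    by apply: eq_bigr => i _; rewrite exprSr mulrA mulfK.
  apply: cvgMl; apply: cvgB; last exact: cvg_cst.
  by rewrite cvg_shiftS.
suff -> : h = q by [].
apply/funext => y; rewrite /q; case: eqP => [->|/eqP /hE//].
rewrite hc; apply: cvg_lim => //.
have := analytic_at_continuous qan; rewrite continuous_withinNx.
rewrite {2}/q eqxx; apply: cvg_trans; apply: near_eq_cvg; near=> y'.
rewrite /q ifN//; near: y'; exact: nbhs_dnbhs_neq.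
Unshelve. all: by end_near. Qed.

Lemma analytic_on_phi f z (D : set C) k : analytic_on f D ->
  (forall i, D (z i)) -> analytic_on (phi f z k) D.
Proof.
move=> fD zD; elim: k => [//|k IH] x Dx.
have [->|xz] := eqVneq x (z k).
  apply: (analytic_at_quot_eq (IH _ (zD k))) => /= [y yz|]; last by rewrite eqxx.
  by rewrite ifN.
apply: (analytic_at_quot_neq completeC (IH _ Dx) xz) => y yz.
by rewrite /= ifN.
Qed.

(** At the node the factor [x - z k] vanishes, so no limit has to be evaluated. *)
Lemma phi_recE f z k x : phi f z k x = phi f z k (z k) +
  (x - z k) * phi f z k.+1 x.
Proof.
have [->|xz] := eqVneq x (z k); first by rewrite subrr mul0r addr0.
by rewrite /= ifN// mulrC divfK ?subr_eq0// addrC subrK.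
Qed.

(** Leibniz's rule with an affine factor. It is stated on a neighbourhood because the induction
    differentiates the identity. *)
Lemma derive1n_mulXsubC g h c x j : analytic_at h x ->
  (forall y, g y = g c + (y - c) * h y) ->
  \forall y \near x, derive1n j.+1 g y =
    (y - c) * derive1n j.+1 h y + j.+1%:R * derive1n j h y.
Proof.
move=> hx gE.
have step (H G : C -> C) (y N K : C) : derivable H y 1 -> derivable G y 1 ->
    derive1 (fun u => (u - c) * H u + N * G u + K) y =
    (y - c) * derive1 H y + H y + N * derive1 G y.
  move=> dH dG; have -> : (fun u => (u - c) * H u + N * G u + K) =
      (shift (- c) : C -> C) * H + N \*: G + cst K by [].
  have dE := is_deriveD (is_deriveD (is_deriveM (is_derive_shift y 1 (- c))
    (derivableP dH)) (is_deriveZ N (derivableP dG))) (is_derive_cst K y 1).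
  rewrite !derive1E (derive_val (is_derive := dE)) addr0 /GRing.scale /= mulr1.
  by [].
have pred_derive i y : i%:R * derive1 (derive1n i.-1 h) y = i%:R * derive1n i h y.
  by case: i => [|i]; rewrite ?mul0r.
(* Order 0 is included to start the induction: there [i.-1] is harmless, its coefficient being 0,
   and the constant [g c] is still present. *)
have gE' i : \forall y \near x, derive1n i g y =
    (y - c) * derive1n i h y + i%:R * derive1n i.-1 h y +
      (if i == 0%N then g c else 0).
  elim: i => [|i IH]; first by near=> y; rewrite mul0r addr0 addrC.
  apply: filterS3 (near_join IH) (analytic_at_derive1n_derivable i hx)
    (analytic_at_derive1n_derivable i.-1 hx) => y IHy d1 d2.
  rewrite derive1nS (derive1_near_eq IHy).
  rewrite (step _ _ _ i%:R (if i == 0%N then g c else 0) d1 d2).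
  rewrite /= addr0 -natr1 [(i%:R + 1) * _]mulrDl mul1r -addrA; congr (_ + _).
  by rewrite addrC pred_derive.
move: (gE' j.+1); apply: filterS => y ->.
by rewrite addr0.
Unshelve. all: by end_near. Qed.

Lemma derive1n_mulXsubC_eq g h c x j : analytic_at h x ->
  (forall y, g y = g c + (y - c) * h y) ->
  derive1n j.+1 g x = (x - c) * derive1n j.+1 h x + j.+1%:R * derive1n j h x.
Proof. by move=> hx gE; have /nbhs_singleton := derive1n_mulXsubC j hx gE. Qed.

(** Polynomial and analytic derivatives obey the same Leibniz rule, so interpolation survives
    multiplication by ['X - c%:P]. *)
Lemma hermite_interpolates_mulXsubC g h c n (B : 'M[C]_n) p :
  (forall x, root (char_poly B) x -> analytic_at h x) ->
  (forall y, g y = g c + (y - c) * h y) ->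
  hermite_interpolates h B p ->
  hermite_interpolates g B ((g c)%:P + ('X - c%:P) * p).
Proof.
move=> hB gE hp x [|j] jx.
  have px : p.[x] = h x := hp x 0%N jx.
  by rewrite derivn0 !hornerE px; exact/esym/gE.
have rx : root (char_poly B) x.
  by apply: contraLR jx => /mupNroot->.
rewrite (derive1n_mulXsubC_eq _ (hB _ rx) gE) derivnD derivnM_XsubC derivnC.
rewrite add0r hornerD hornerMn hornerM hornerXsubC hp// (hp _ j) ?(ltnW jx)//.
by rewrite -mulr_natl.
Qed.

Lemma mx_eval_mulXsubC n (B : 'M[C]_n) p a c :
  mx_eval (a%:P + ('X - c%:P) * p) B = a%:M + (B - c%:M) *m mx_eval p B.
Proof.
case: n B => [|n] B; first by apply/matrixP => -[].
rewrite !mx_evalE rmorphD rmorphM rmorphB /= horner_mx_X !horner_mx_C.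
by [].
Qed.

Lemma mxfun_mulXsubC g h c n (B : 'M[C]_n) :
  (forall x, root (char_poly B) x -> analytic_at h x) ->
  (forall y, g y = g c + (y - c) * h y) ->
  mxfun g B = (g c)%:M + (B - c%:M) *m mxfun h B.
Proof.
move=> hB gE; have [p hp] := hermite_interpolant_ex h B.
rewrite (mxfunE hp) (mxfunE (hermite_interpolates_mulXsubC hB gE hp)).
exact: mx_eval_mulXsubC.
Qed.

End Quotient.

(** * Completeness of the complex numbers *)

Section ComplexField.
Variable R : realType.
Local Notation C := (R[i] : numClosedFieldType).
Local Notation Re := (@complex.Re R).
Local Notation Im := (@complex.Im R).
Implicit Types (z w : R[i]).

Lemma normc_real (x : R) : `|x%:C| = `|x|%:C.
Proof. by rewrite normc_def /= expr0n addr0 sqrtr_sqr. Qed.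

Lemma normc_i : `|'i%C| = 1 :> R[i].
Proof. by rewrite normc_def /= expr0n expr1n add0r sqrtr1. Qed.

Lemma ler_normc_ReIm z : `|z| <= (`|Re z| + `|Im z|)%:C.
Proof.
rewrite {1}(complexE z) (le_trans (ler_normD _ _))// rmorphD /= -!normc_real.
by rewrite normrM normc_i mul1r.
Qed.

Lemma normc_ge_Im z : `|Im z|%:C <= `|z|.
Proof.
by rewrite -[Im z]opprK -ReiNIm normrN (le_trans (normc_ge_Re _))// normrM
  normc_i mulr1.
Qed.

Lemma ge0_complexE z : 0 <= z -> z = (Re z)%:C.
Proof. by move=> z0; rewrite RRe_real// ger0_real. Qed.

Lemma Re_series (u : nat -> R[i]) n : Re (series u n) = series (fun n => Re (u n)) n.
Proof.
elim: n => [|n IH]; first by rewrite /series /= !big_geq.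
by rewrite !seriesS -IH; case: (u n) (series u n) => [? ?] [? ?].
Qed.

Lemma Im_series (u : nat -> R[i]) n : Im (series u n) = series (fun n => Im (u n)) n.
Proof.
elim: n => [|n IH]; first by rewrite /series /= !big_geq.
by rewrite !seriesS -IH; case: (u n) (series u n) => [? ?] [? ?].
Qed.

Lemma cvgn_series_half (u : nat -> R) (k : R) :
  (forall n, `|u n| <= k * 2^-1 ^+ n) -> cvgn (series u).
Proof.
move=> uk; apply: (@normed_cvg R R^o).
apply: (@series_le_cvg _ _ (geometric k 2^-1)) => //.
- by move=> n; exact: normr_ge0.
- by move=> n; exact: le_trans (normr_ge0 _) (uk n).
- by apply: is_cvg_geometric_series; rewrite gtr0_norm ?invf_lt1 ?ltr1n.
Qed.

Lemma complex_geometrically_complete : geometrically_complete C.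
Proof.
move=> u K uK; have K0 : 0 <= K.
  by have := uK 0%N; rewrite expr0 mulr1; apply: le_trans.
have half n : K * 2^-1 ^+ n = (Re K * 2^-1 ^+ n)%:C.
  by rewrite rmorphM rmorphXn fmorphV /= -(ge0_complexE K0) rmorph_nat.
have Re_cvg : cvgn (series (fun n => Re (u n))).
  apply: (@cvgn_series_half _ (Re K)) => n.
  by rewrite -lecR -half (le_trans (normc_ge_Re _)).
have Im_cvg : cvgn (series (fun n => Im (u n))).
  apply: (@cvgn_series_half _ (Re K)) => n.
  by rewrite -lecR -half (le_trans (normc_ge_Im _)).
apply/cvg_ex; exists ((limn (series (fun n => Re (u n)))) +i*
  (limn (series (fun n => Im (u n))))).
apply/cvgrPdist_lt => eps eps0.
have eps2 : 0 < Re eps / 2 by rewrite divr_gt0// -ltcR -ge0_complexE// ltW.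
move/cvgrPdist_lt: Re_cvg => /(_ _ eps2) Re_near.
move/cvgrPdist_lt: Im_cvg => /(_ _ eps2) Im_near.
near=> n.
rewrite (le_lt_trans (ler_normc_ReIm _))// (ge0_complexE (ltW eps0)) ltcR.
rewrite (splitr (Re eps)) ltrD//.
  have : `|limn (series (fun n => Re (u n))) - series (fun n => Re (u n)) n| <
    Re eps / 2 by near: n.
  by rewrite -Re_series; case: (series u n).
have : `|limn (series (fun n => Im (u n))) - series (fun n => Im (u n)) n| <
    Re eps / 2 by near: n.
by rewrite -Im_series; case: (series u n).
Unshelve. all: by end_near. Qed.

(** Restricting the complex difference quotient to real increments opens the way to real
    monotonicity arguments. *)
Lemma derivable_Re (F : C -> C) (t : R) : derivable F (t%:C : C) 1 ->
  is_derive t 1 (fun s : R => Re (F s%:C)) (Re (derive1 F t%:C)).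
Proof.
move=> dF.
suff Fcvg : h^-1 *: (((fun s : R => Re (F s%:C)) \o shift t) (h *: 1) -
    Re (F t%:C)) @[h --> 0^'] --> (Re (derive1 F t%:C) : R^o).
  split; first by apply/cvg_ex; exists (Re (derive1 F t%:C)).
  by apply: cvg_lim.
apply/cvgrPdist_lt => eps eps0.
have /cvgrPdist_lt/(_ eps%:C) := dF; rewrite ltcR => /(_ eps0).
rewrite -/('D_1 F t%:C) -derive1E => /nbhs_ballP[d /= d0 dP].
near=> h.
have h0 : h != 0 by near: h; exact: nbhs_dnbhs_neq.
have hd : `|h| < Re d.
  near: h; apply: nbhs_dnbhs; apply: (@nbhs0_lt _ R^o).
  by rewrite -ltcR -ge0_complexE// ltW.
have := dP h%:C; rewrite -ball_normE /= sub0r normrN normc_real.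
rewrite (ge0_complexE (ltW d0)) ltcR => /(_ hd).
have hC0 : h%:C != 0 by rewrite (fmorph_eq0 (real_complex R)).
move=> /(_ hC0); rewrite -ltcR; apply: le_lt_trans.
apply: le_trans (normc_ge_Re _); rewrite lecR le_eqVlt; apply/orP; left; apply/eqP.
congr (`|_|).
rewrite /GRing.scale /= !mulr1 -fmorphV -rmorphD /=.
by case: (F _) (F _) (derive1 _ _) => [? ?] [? ?] [? ?] /=; simpc.
Unshelve. all: by end_near. Qed.

End ComplexField.

(** * The mean value bound on divided differences *)

Lemma derivable1_comp (C : numFieldType) (f g : C -> C) x :
  derivable f x 1 -> derivable g (f x) 1 ->
  derivable (g \o f) x 1 /\ derive1 (g \o f) x = derive1 g (f x) * derive1 f x.
Proof.
move=> /derivable1_diffP df /derivable1_diffP dg.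
split; first exact/derivable1_diffP/differentiable_comp.
rewrite derive1E'; last exact/differentiable_comp.
rewrite diff_comp // !derive1E' //= -[X in 'd  _ _ X = _]mulr1.
by rewrite [LHS]linearZ mulrC.
Qed.

(** For [H] the [j]-th derivative of the quotient [h] and [d = x - c], Leibniz's rule turns the
    bracket into the derivative of order [j.+1] of [g]. *)
Lemma is_derive_pow_affine (C : numFieldType) (H : C -> C) (c d s : C) j :
  derivable H (c + s * d) 1 ->
  is_derive s 1 (fun s => s ^+ j.+1 * H (c + s * d))
    (s ^+ j * (j.+1%:R * H (c + s * d) + s * d * derive1 H (c + s * d))).
Proof.
move=> dH.
have Da : is_derive s 1 (fun s => c + s * d) d.
  apply: (is_derive_eq (is_deriveD (is_derive_cst c s 1)
    (is_deriveM (is_derive_id s 1) (is_derive_cst d s 1)))).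
  by rewrite /GRing.scale /= mulr0 mulr1 !add0r.
have DaE : derive1 (fun s => c + s * d) s = d.
  by rewrite derive1E; exact: derive_val.
have [Dc Dc'] := @derivable1_comp _ (fun s => c + s * d) H s
  (ex_derive (is_derive := Da)) dH.
have D := is_deriveM (is_deriveX j.+1 (is_derive_id s 1))
  (derivableP Dc).
have -> : (fun s => s ^+ j.+1 * H (c + s * d)) =
    id ^+ j.+1 * (H \o (fun s => c + s * d)).
  by apply/funext => t /=; rewrite -[RHS]/((id ^+ j.+1) t * _) exprfctE.
apply: is_derive_eq D _; rewrite -derive1E Dc' DaE.
rewrite /GRing.scale /= /cst /= !exprfctE exprS; ring.
Qed.

Section MeanValue.
Variable R : realType.
Local Notation C := (R[i] : numClosedFieldType).
Local Notation Re := (@complex.Re R).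

(** A unimodular [u] rotates the increment of [G] onto the nonnegative reals. Subtracting the
    antiderivative of [M * t ^+ j] from the real part then leaves a nonincreasing function [psi],
    which replaces integration. *)
Lemma mean_value_bound (G : C -> C) (M : R) j :
  (forall t : R, 0 <= t <= 1 -> derivable G (t%:C : C) 1 /\
    `|derive1 G (t%:C : C)| <= (M * t ^+ j)%:C) ->
  `|G 1 - G 0| <= (M / j.+1%:R)%:C.
Proof.
move=> GM; set d := G 1 - G 0.
have [u u1 ud] : exists2 u : C, `|u| = 1 & u * d = `|d|.
  have [->|d0] := eqVneq d 0; first by exists 1; rewrite ?normr1// mulr0 normr0.
  exists (`|d| / d); first by rewrite normrM normr_id normfV divff ?normr_eq0.
  by rewrite divfK.
pose psi (t : R) := Re (u * G t%:C) - M / j.+1%:R * t ^+ j.+1.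
have dpsi (t : R) : 0 <= t <= 1 ->
    is_derive t 1 psi (Re (u * derive1 G t%:C) - M * t ^+ j).
  move=> /GM[dG _].
  have duG := is_deriveZ u (derivableP dG).
  have DRe := derivable_Re (ex_derive (is_derive := duG)).
  have D := is_deriveB DRe
    (is_deriveZ (M / j.+1%:R) (is_deriveX j.+1 (is_derive_id t 1))).
  have -> : psi = (fun t => Re (u * G t%:C)) - (M / j.+1%:R) \*: id ^+ j.+1.
    by apply/funext => r; rewrite /psi -[RHS]/(_ - _ *: (id ^+ j.+1) r) exprfctE.
  apply: is_derive_eq D _; rewrite !derive1E (derive_val (is_derive := duG)).
  rewrite /GRing.scale /= mulr1; congr (_ - _); field.
  by rewrite addrC natr1 pnatr_eq0.
have : psi 1 <= psi 0.
  apply: (@ler0_derive1_le_cc _ psi 0 1); rewrite ?in_itv /= ?lexx ?ler01//.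
  - move=> t; rewrite in_itv /= => /andP[t0 t1].
    have t01 : 0 <= t <= 1 by rewrite !ltW.
    exact: (ex_derive (is_derive := dpsi t t01)).
  - move=> t; rewrite in_itv /= => /andP[t0 t1].
    have t01 : 0 <= t <= 1 by rewrite !ltW.
    rewrite derive1E (derive_val (is_derive := dpsi t t01)) subr_le0 -lecR.
    have [_] := GM t t01; apply: le_trans.
    rewrite -[leRHS]mul1r -u1 -normrM (le_trans _ (normc_ge_Re _))// lecR.
    exact: ler_norm.
  - apply: derivable_within_continuous => t; rewrite in_itv /= => t01.
    exact: (ex_derive (is_derive := dpsi t t01)).
rewrite /psi expr1n expr0n /= mulr0 subr0 mulr1 lerBlDr -lerBlDl => dle.
rewrite -ud (_ : u * d = (Re (u * d))%:C); last by apply: ge0_complexE; rewrite ud.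
rewrite lecR (le_trans _ dle)// /d mulrBr.
by case: (u * G 1) (u * G 0) => [? ?] [? ?].
Qed.

Lemma convex_set_segment (D : set R[i]) (x c : R[i]) (t : R) : convex_set D ->
  D x -> D c -> 0 <= t <= 1 -> D (c + t%:C * (x - c)).
Proof.
move=> cD Dx Dc /andP[t0 t1].
have tC0 : 0 <= t%:C by rewrite ler0c.
have tC1 : t%:C <= 1 by rewrite lecR.
have := cD x c (Itv01 tC0 tC1); rewrite !inE => /(_ Dx Dc).
congr D; rewrite /conv /= /unstable.onem.
rewrite -[_ *: x]/(t%:C * x) -[_ *: c]/((1 - t%:C) * c).
by rewrite mulrBl mul1r mulrBr addrCA addrA addrAC.
Qed.

Lemma derive1n_quot_bound (D : set R[i]) (g h : C -> C) c (M : R) j :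
  convex_set D -> D c -> analytic_on h D ->
  (forall y, g y = g c + (y - c) * h y) ->
  (forall x, D x -> `|derive1n j.+1 g x| <= M%:C) ->
  forall x, D x -> `|derive1n j h x| <= (M / j.+1%:R)%:C.
Proof.
move=> cD Dc hD gE gM x Dx.
have gc := @complex_geometrically_complete R.
(* [G] runs from 0 to the derivative to be bounded, and its own derivative is [s ^+ j] times that of
   order [j.+1] of [g] on the segment, which convexity keeps in [D]. *)
pose G (s : C) := s ^+ j.+1 * derive1n j h (c + s * (x - c)).
have -> : derive1n j h x = G 1 - G 0.
  by rewrite /G expr1n expr0n /= mul0r subr0 !mul1r addrC subrK.
apply: mean_value_bound => t t01.
have Dy := convex_set_segment cD Dx Dc t01; set y := c + _ in Dy.
have dh : derivable (derive1n j h) y 1.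
  exact: nbhs_singleton (analytic_at_derive1n_derivable gc j (hD y Dy)).
have DG := is_derive_pow_affine j dh.
split; first exact: (ex_derive (is_derive := DG)).
rewrite derive1E (derive_val (is_derive := DG)) -/y.
rewrite (_ : t%:C * (x - c) = y - c); last by rewrite /y addrAC subrr add0r.
rewrite addrC -[derive1 _ y]/(derive1n j.+1 h y).
rewrite -(derive1n_mulXsubC_eq gc j (hD y Dy) gE).
have [t0 _] := andP t01; rewrite normrM normrX normc_real (ger0_norm t0).
rewrite mulrC rmorphM rmorphXn /=.
apply: ler_wpM2r; last exact: gM.
by rewrite exprn_ge0// ler0c.
Qed.
End MeanValue.

(** * The Newton expansion of the error *)

Section MatrixNorm.
Variable C : numDomainType.

(** The entrywise sum is submultiplicative for all rectangular shapes, but the identity does not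
    have norm 1, hence the factors [mxnorm1 1%:M] below. *)
Definition mxnorm1 m n (B : 'M[C]_(m, n)) : C := \sum_i \sum_j `|B i j|.

Lemma mxnorm1_ge0 m n (B : 'M[C]_(m, n)) : 0 <= mxnorm1 B.
Proof. by apply: sumr_ge0 => i _; apply: sumr_ge0. Qed.

Lemma ler_mxnorm1 m n (B : 'M[C]_(m, n)) i j : `|B i j| <= mxnorm1 B.
Proof.
rewrite /mxnorm1 (bigD1 i)//= (bigD1 j)//= -addrA lerDl addr_ge0//.
  by apply: sumr_ge0.
by apply: sumr_ge0 => i' _; apply: sumr_ge0.
Qed.

Lemma ler_mxnorm1D m n (A B : 'M[C]_(m, n)) :
  mxnorm1 (A + B) <= mxnorm1 A + mxnorm1 B.
Proof.
rewrite /mxnorm1 -big_split ler_sum//= => i _.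
by rewrite -big_split ler_sum//= => j _; rewrite mxE ler_normD.
Qed.

Lemma mxnorm1Z m n a (B : 'M[C]_(m, n)) : mxnorm1 (a *: B) = `|a| * mxnorm1 B.
Proof.
rewrite /mxnorm1 mulr_sumr; apply: eq_bigr => i _; rewrite mulr_sumr.
by apply: eq_bigr => j _; rewrite mxE normrM.
Qed.

Lemma mxnorm1N m n (B : 'M[C]_(m, n)) : mxnorm1 (- B) = mxnorm1 B.
Proof. by rewrite -scaleN1r mxnorm1Z normrN1 mul1r. Qed.

Lemma ler_mxnorm1M m n p (A : 'M[C]_(m, n)) (B : 'M[C]_(n, p)) :
  mxnorm1 (A *m B) <= mxnorm1 A * mxnorm1 B.
Proof.
rewrite /mxnorm1 mulr_suml ler_sum//= => i _.
apply: (@le_trans _ _ (\sum_k \sum_j `|A i j| * `|B j k|)).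
  rewrite ler_sum// => k _; rewrite mxE (le_trans (ler_norm_sum _ _ _))//.
  by rewrite ler_sum// => j _; rewrite normrM.
rewrite exchange_big mulr_suml ler_sum//= => j _.
rewrite -mulr_sumr ler_wpM2l// (bigD1 j)//= lerDl.
by apply: sumr_ge0 => i' _; apply: sumr_ge0.
Qed.

Lemma ler_mxnorm1_sum m n I (r : seq I) (F : I -> 'M[C]_(m, n)) :
  mxnorm1 (\sum_(i <- r) F i) <= \sum_(i <- r) mxnorm1 (F i).
Proof.
elim/big_ind2: _ => // [|B b D d Bb Dd].
  by rewrite /mxnorm1 big1// => i _; rewrite big1// => j _; rewrite mxE normr0.
by rewrite (le_trans (ler_mxnorm1D _ _))// lerD.
Qed.

End MatrixNorm.

(** * Eigenvalues, Newton polynomials and the error recursion *)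

Section Krylov.
Variable C : numClosedFieldType.
Implicit Types (f g h : C -> C) (z : nat -> C).
Local Open Scope sesquilinear_scope.

(** Eigenvectors here are rows [u] with [u *m B = a *: u]; the unit vector is the normalised
    conjugate transpose of [u]. *)
Lemma root_char_poly_field_of_values n (B : 'M[C]_n) a :
  root (char_poly B) a -> field_of_values B a.
Proof.
rewrite -eigenvalue_root_char => /eigenvalueP[u uB u0].
pose s := \sum_i `|u 0 i| ^+ 2.
have s0 : 0 < s.
  rewrite lt_neqAle sumr_ge0 ?andbT => [|i _]; last exact: exprn_ge0.
  apply: contra_neq u0 => /esym/eqP; rewrite psumr_eq0 => [/allP us|i _].
    apply/rowP => i; rewrite mxE; apply/eqP; rewrite -normr_eq0 -sqrf_eq0.
    by apply: us; rewrite mem_index_enum.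
  exact: exprn_ge0.
pose t := (sqrtC s)^-1.
have t0 : 0 <= t by rewrite invr_ge0 sqrtC_ge0 ltW.
have tt : t * t * s = 1.
  by rewrite -expr2 exprVn sqrtCK mulVf// gt_eqF.
pose x : 'cV[C]_n := t *: u ^t*.
have xE : x ^t* = t *: u.
  apply/matrixP => i j; rewrite !mxE rmorphM /= conjCK ord1.
  by rewrite (CrealP (ger0_real t0)).
have xx : x ^t* *m x = 1%:M.
  rewrite xE; apply/matrixP => i j; rewrite !ord1 !mxE /= -tt -mulrA mulr_sumr.
  rewrite mulr_sumr; apply: eq_bigr => k _; rewrite !mxE normCK; ring.
exists x => //; rewrite xE -scalemxAl uB scalerA mulrC -scalerA -xE.
by rewrite -scalemxAl xx !mxE mulr1.
Qed.

Lemma newton_polyS z n : newton_poly z n.+1 = newton_poly z n * ('X - (z n)%:P).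
Proof. by rewrite /newton_poly big_ord_recr. Qed.

Lemma mx_eval_newton_poly0 z n (A : 'M[C]_n) : mx_eval (newton_poly z 0) A = 1%:M.
Proof. by rewrite /newton_poly big_ord0 /mx_eval size_poly1 big_ord1 coef1 scale1r. Qed.

Lemma mx_eval_newton_polyS z n k (A : 'M[C]_n) :
  mx_eval (newton_poly z k.+1) A = mx_eval (newton_poly z k) A *m (A - (z k)%:M).
Proof.
case: n A => [|n] A; first by apply/matrixP => -[].
by rewrite newton_polyS !mx_evalE rmorphM rmorphB /= horner_mx_X horner_mx_C.
Qed.

Lemma mx_eval_char_poly n (A : 'M[C]_n) : mx_eval (char_poly A) A = 0.
Proof.
case: n A => [|n] A; first by apply/matrixP => -[].
by rewrite mx_evalE Cayley_Hamilton.
Qed.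

Lemma ler_mxnorm1_newton_poly z n (A : 'M[C]_n) (B : C) k :
  (forall i, `|z i| <= B) ->
  mxnorm1 (mx_eval (newton_poly z k) A) <=
    mxnorm1 (1%:M : 'M[C]_n) * (mxnorm1 A + B * mxnorm1 (1%:M : 'M[C]_n)) ^+ k.
Proof.
move=> zB; elim: k => [|k IH]; first by rewrite mx_eval_newton_poly0 expr0 mulr1.
rewrite mx_eval_newton_polyS (le_trans (ler_mxnorm1M _ _))// exprSr mulrA.
rewrite ler_pM ?mxnorm1_ge0// (le_trans (ler_mxnorm1D _ _))// mxnorm1N lerD2l.
by rewrite -(scalemx1 _ (z k)) mxnorm1Z ler_wpM2r// mxnorm1_ge0.
Qed.

Hypothesis completeC : geometrically_complete C.

Lemma mxfun_phi_rec (D : set C) f z n (B : 'M[C]_n) k :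
  analytic_on f D -> (forall i, D (z i)) -> field_of_values B `<=` D ->
  mxfun (phi f z k) B = (phi f z k (z k))%:M +
    (B - (z k)%:M) *m mxfun (phi f z k.+1) B.
Proof.
move=> fD zD BD; apply: mxfun_mulXsubC => //; last exact: phi_recE.
by move=> x /root_char_poly_field_of_values/BD; apply: analytic_on_phi.
Qed.

Lemma mxfun_newton (D : set C) f z n (B : 'M[C]_n) k :
  analytic_on f D -> (forall i, D (z i)) -> field_of_values B `<=` D ->
  mxfun f B = \sum_(i < k) phi f z i (z i) *: mx_eval (newton_poly z i) B +
    mx_eval (newton_poly z k) B *m mxfun (phi f z k) B.
Proof.
move=> fD zD BD; elim: k => [|k IH].
  by rewrite big_ord0 add0r mx_eval_newton_poly0 mul1mx.
rewrite IH (mxfun_phi_rec k fD zD BD) big_ord_recr /= mulmxDr mul_mx_scalar.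
by rewrite mulmxA -mx_eval_newton_polyS addrA.
Qed.

(** The constant [a] cancels because [W *m b = v]; commuting [W] past [K - c%:M] produces the
    rank-one term. *)
Lemma krylov_like_error_rec N n (A : 'M[C]_N) v (W : 'M[C]_(N, n)) K w k b g h a c :
  A *m W = W *m K + w *m k^T -> W *m b = v ->
  mxfun g A = a%:M + (A - c%:M) *m mxfun h A ->
  mxfun g K = a%:M + (K - c%:M) *m mxfun h K ->
  krylov_like_error g A v W K b =
    (k^T *m mxfun h K *m b) 0 0 *: w +
    (A - c%:M) *m krylov_like_error h A v W K b.
Proof.
move=> AW Wb gA gK; rewrite /krylov_like_error gA gK.
have WK : W *m (K - c%:M) = (A - c%:M) *m W - w *m k^T.
  by rewrite mulmxBr mulmxBl AW mul_mx_scalar mul_scalar_mx addrAC addrK.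
have kYb : w *m k^T *m mxfun h K *m b = (k^T *m mxfun h K *m b) 0 0 *: w.
  by rewrite -!(mulmxA w) [X in w *m X]mx11_scalar mul_mx_scalar.
have -> : W *m (a%:M + (K - c%:M) *m mxfun h K) *m b =
    a *: v + ((A - c%:M) *m W *m mxfun h K *m b - (k^T *m mxfun h K *m b) 0 0 *: w).
  rewrite mulmxDr mulmxDl mul_mx_scalar -scalemxAl Wb mulmxA WK; congr (_ + _).
  by rewrite !mulmxBl kYb.
rewrite mulmxDl mul_scalar_mx [in RHS]mulmxBr -!mulmxA opprD opprB.
by rewrite addrACA subrr add0r addrCA.
Qed.

Lemma krylov_like_error_newton (D : set C) N n (A : 'M[C]_N) v (W : 'M[C]_(N, n))
    K w k b f z j :
  analytic_on f D -> (forall i, D (z i)) ->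
  field_of_values A `<=` D -> field_of_values K `<=` D ->
  A *m W = W *m K + w *m k^T -> W *m b = v ->
  krylov_like_error f A v W K b =
    \sum_(1 <= i < j.+1)
      (k^T *m mxfun (phi f z i) K *m b) 0 0 *:
        (mx_eval (newton_poly z i.-1) A *m w) +
    mx_eval (newton_poly z j) A *m krylov_like_error (phi f z j) A v W K b.
Proof.
move=> fD zD AD KD AW Wb; elim: j => [|j IH].
  by rewrite big_geq// add0r mx_eval_newton_poly0 mul1mx.
rewrite {}IH (krylov_like_error_rec AW Wb (mxfun_phi_rec j fD zD AD)
  (mxfun_phi_rec j fD zD KD)).
rewrite [in RHS]big_nat_recr//= mulmxDr -scalemxAr addrA mulmxA.
by rewrite -mx_eval_newton_polyS.
Qed.

End Krylov.

(** * Convergence *)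

Section NewtonBounds.
Variable R : realType.
Local Notation C := (R[i] : numClosedFieldType).
Local Notation Re := (@complex.Re R).
Implicit Types (D : set R[i]) (f : C -> C) (z : nat -> C).

(** Each new node costs one derivative: the bound on order [j.+1] for [phi_k], divided by [j + 1],
    is the bound on order [j] for [phi_(k+1)]. *)
Lemma derive1n_phi_bound D f z (M : R) k j :
  convex_set D -> analytic_on f D -> (forall i, D (z i)) ->
  (forall i x, D x -> `|derive1n i f x| <= M%:C) ->
  forall x, D x -> `|derive1n j (phi f z k) x| <= (M * j`!%:R / (k + j)`!%:R)%:C.
Proof.
move=> cD fD zD fM; elim: k j => [|k IH] j x Dx.
  by rewrite add0n mulfK ?pnatr_eq0 -?lt0n ?fact_gt0//; exact: fM.
have := derive1n_quot_bound cD (zD k)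
  (analytic_on_phi (@complex_geometrically_complete R) k.+1 fD zD)
  (phi_recE f z k) (IH j.+1) Dx.
rewrite addnS -addSn (factS j) natrM [j.+1%:R * _]mulrC mulrA [_ / _ / _]mulrAC.
by rewrite mulfK ?pnatr_eq0.
Qed.

(** By [j! k! <= (k + j)!] the bound is uniform in [j], so [phi f z k] itself meets the hypothesis
    of [mxfun_bound]. *)
Lemma derive1n_phi_bound_fact D f z (M : R) k j :
  convex_set D -> analytic_on f D -> (forall i, D (z i)) ->
  (forall i x, D x -> `|derive1n i f x| <= M%:C) ->
  forall x, D x -> `|derive1n j (phi f z k) x| <= (M / k`!%:R)%:C.
Proof.
move=> cD fD zD fM x Dx.
have M0 : 0 <= M by rewrite -ler0c (le_trans _ (fM 0%N x Dx)).
rewrite (le_trans (derive1n_phi_bound k j cD fD zD fM Dx))// lecR -mulrA.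
rewrite ler_wpM2l// ler_pdivrMr ?ltr0n ?fact_gt0// mulrC.
rewrite ler_pdivlMr ?ltr0n ?fact_gt0// -natrM ler_nat.
have := bin_fact (leq_addr j k); rewrite addKn => <-.
by rewrite mulnC leq_pmull// bin_gt0 leq_addr.
Qed.

(** [K] is chosen before [f], so one constant serves every [phi_n]. With the eigenvalues as nodes
    the Newton remainder vanishes by Cayley-Hamilton. *)
Lemma mxfun_bound D n (B : 'M[C]_n) : convex_set D -> field_of_values B `<=` D ->
  exists2 K : R, 0 <= K & forall f (M : R), analytic_on f D ->
    (forall i x, D x -> `|derive1n i f x| <= M%:C) ->
    mxnorm1 (mxfun f B) <= (K * M)%:C.
Proof.
move=> cD BD; case: n => [|n] in B BD *.
  by exists 0 => // f M _ _; rewrite mul0r /mxnorm1 big_ord0.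
have [s sE] := closed_field_poly_normal (char_poly B).
rewrite (monicP (char_poly_monic B)) scale1r in sE.
have ss : size s = n.+1.
  by have := size_char_poly B; rewrite sE size_prod_XsubC => -[].
(* Past the last eigenvalue the sequence repeats the first one, so that every node lies in [D]. *)
pose z i : C := nth (nth 0 s 0) s i.
have zD i : D (z i).
  apply: BD; apply: root_char_poly_field_of_values; rewrite sE root_prod_XsubC.
  rewrite /z; have [ni|ni] := leqP (size s) i; last exact: mem_nth.
  by rewrite nth_default// mem_nth// ss.
have zE : newton_poly z n.+1 = char_poly B.
  by rewrite sE (big_nth (nth 0 s 0)) big_mkord ss.
pose K := \sum_(i < n.+1) mxnorm1 (mx_eval (newton_poly z i) B).
have K0 : 0 <= K by apply: sumr_ge0 => i _; apply: mxnorm1_ge0.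
exists (Re K) => [|f M fD fM]; first by rewrite -ler0c -ge0_complexE.
have M0 : 0 <= M by rewrite -ler0c (le_trans _ (fM 0%N _ (zD 0%N))).
rewrite (mxfun_newton (@complex_geometrically_complete R) n.+1 fD zD BD) zE.
rewrite mx_eval_char_poly mul0mx addr0 (le_trans (ler_mxnorm1_sum _ _))//.
rewrite rmorphM /= -ge0_complexE// mulr_suml ler_sum// => i _.
rewrite mxnorm1Z mulrC ler_wpM2l ?mxnorm1_ge0//.
have := derive1n_phi_bound_fact i 0 cD fD zD fM (zD i).
move=> /le_trans; apply; rewrite lecR ler_pdivrMr ?ltr0n ?fact_gt0//.
by rewrite ler_peMr// ler1n fact_gt0.
Qed.

Lemma cvg_mxnorm1 m n (u : nat -> 'M[C]_(m, n)) (U : 'M[C]_(m, n)) (e : nat -> R) :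
  (forall k, mxnorm1 (U - u k) <= (e k)%:C) -> e @ \oo --> 0 -> u @ \oo --> U.
Proof.
move=> ue /cvgrPdist_lt e0; apply/cvg_ballP => eps eps0.
have eps1 : 0 < Re eps by rewrite -ltcR -ge0_complexE// ltW.
near=> k; split=> // i j; rewrite -ball_normE /=.
rewrite (le_lt_trans _ (_ : (e k)%:C < eps))//.
  rewrite (le_trans _ (ue k))//.
  by have := ler_mxnorm1 (U - u k) i j; rewrite !mxE.
rewrite (ge0_complexE (ltW eps0)) ltcR (le_lt_trans (ler_norm _))//.
rewrite -normrN -[- e k]add0r; near: k; exact: e0.
Unshelve. all: by end_near. Qed.
End NewtonBounds.

Theorem theorem3p1 (R : realType) (N m l : nat)
  (A : 'M[R[i]]_N) (v : 'cV[R[i]]_N)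
  (W : 'M[R[i]]_(N, m + l)) (K : 'M[R[i]]_(m + l))
  (w : 'cV[R[i]]_N) (k : 'cV[R[i]]_(m + l))
  (Omega : set R[i]) (f : R[i] -> R[i]) (M : R)
  (z : nat -> R[i]) (b : 'cV[R[i]]_(m + l)) :
  krylov_like A v W K w k ->
  closed Omega -> convex_set Omega ->
  analytic_on f Omega ->
  field_of_values A `<=` Omega -> field_of_values K `<=` Omega ->
  0 < M ->
  (forall (j : nat) (x : R[i]), Omega x -> `|derive1n j f x| <= M%:C) ->
  (forall i : nat, Omega (z i)) ->
  equal_points_contiguous z ->
  W *m b = v ->
  (bounded_set (range z) ->
   (\sum_(1 <= j < n.+1)
      (k^T *m mxfun (phi f z j) K *m b) 0 0 *:
        (mx_eval (newton_poly z j.-1) A *m w)) @[n --> \oo]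
     --> krylov_like_error f A v W K b) /\
  (char_poly A = \prod_(i < N) ('X - (z i)%:P) ->
   krylov_like_error f A v W K b =
     \sum_(1 <= j < N.+1)
       (k^T *m mxfun (phi f z j) K *m b) 0 0 *:
         (mx_eval (newton_poly z j.-1) A *m w)).
Proof.
move=> [AW _ _ _] _ cO fO AO KO M0 fM zO _ Wb.
have gc := @complex_geometrically_complete R.
have E n := krylov_like_error_newton gc n fO zO AO KO AW Wb.
split=> [zb|zN]; last first.
  by rewrite (E N) (_ : newton_poly z N = char_poly A)// mx_eval_char_poly mul0mx addr0.
have [B zB] : exists B : R[i], forall i, `|z i| <= B.
  have [B zB] := (@ex_bound _ _ _ _ (globally (range z))
    (globally_properfilter (imageT z 0%N))).1 zb.
  by exists B => i; apply: zB; exists i.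
have [KA KA0 KAP] := mxfun_bound cO AO.
have [KK KK0 KKP] := mxfun_bound cO KO.
pose rho : R[i] := mxnorm1 A + B * mxnorm1 (1%:M : 'M[R[i]]_N).
have rho0 : 0 <= rho.
  by rewrite addr_ge0 ?mulr_ge0 ?mxnorm1_ge0// (le_trans _ (zB 0%N)).
pose c : R[i] := mxnorm1 (1%:M : 'M[R[i]]_N) *
  (KA%:C * mxnorm1 v + mxnorm1 W * KK%:C * mxnorm1 b) * M%:C.
have c0 : 0 <= c.
  by rewrite !(mulr_ge0, addr_ge0) ?mxnorm1_ge0 ?ler0c// ltW.
(* The remainder is at most [c * rho ^+ n / n!], where [rho] bounds the growth of [q_n(A)] and [c]
   collects the constants free of [n]. *)
apply: (@cvg_mxnorm1 _ _ _ _ _ (fun n => complex.Re c * exp_coeff (complex.Re rho) n)).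
  move=> n; rewrite (E n) addrC addKr.
  have phiO := analytic_on_phi gc n fO zO.
  have phiM i := derive1n_phi_bound_fact n i cO fO zO fM.
  rewrite (le_trans (ler_mxnorm1M _ _))//.
  rewrite (le_trans (ler_pM _ _ (ler_mxnorm1_newton_poly A n zB) (lexx _)))
    ?mxnorm1_ge0//.
  have -> : (complex.Re c * exp_coeff (complex.Re rho) n)%:C =
      mxnorm1 (1%:M : 'M[R[i]]_N) * rho ^+ n * ((KA * (M / n`!%:R))%:C * mxnorm1 v +
        mxnorm1 W * (KK * (M / n`!%:R))%:C * mxnorm1 b).
    rewrite /exp_coeff !rmorphM rmorphXn fmorphV /= -!ge0_complexE//.
    by rewrite /c; ring.
  rewrite ler_wpM2l ?mulr_ge0 ?exprn_ge0 ?mxnorm1_ge0//.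
  rewrite (le_trans (ler_mxnorm1D _ _))// mxnorm1N lerD//.
    by rewrite (le_trans (ler_mxnorm1M _ _))// ler_wpM2r ?mxnorm1_ge0// KAP.
  rewrite (le_trans (ler_mxnorm1M _ _))// ler_wpM2r ?mxnorm1_ge0//.
  by rewrite (le_trans (ler_mxnorm1M _ _))// ler_wpM2l ?mxnorm1_ge0// KKP.
rewrite -(mulr0 (complex.Re c)); apply: cvgMr.
exact: cvg_series_cvg_0 (is_cvg_series_exp_coeff _).
Qed.
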